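(* For all integers $n,\lambda,r\ge 0$ and $m,x\ge 1$, $$D^{\lambda,x}_{m,r}(n+1)=r\,D^{\lambda,x}_{m,r}(n)+x\lambda\,D^{\lambda,x}_{m,m+r}(n).$$
   Context: For integers $n,r,\lambda\ge 0$ and $m,x\ge 1$, $D^{\lambda,x}_{m,r}(n)$ (the higher order non-degenerate $r$-Dowling polynomial) is the number of $(r,m,x,\lambda)$-partitions of $\{1,\ldots,n+r\}$, i.e. set partitions of $\{1,\ldots,n+r\}$ carrying the following extra data. (i) The elements $1,\ldots,r$ lie in $r$ distinct blocks, called distinguished blocks; all other blocks are called non-distinguished. (ii) In each non-distinguished block every element except the largest one is colored independently with one of $m$ colors. (iii) Each non-distinguished block is colored independently with one of $x$ colors. (iv) Each non-distinguished block is assigned independently to one of $\lambda$ sections. (v) Neither the distinguished blocks nor their elements are colored. *)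

(* Defs.v *)
From mathcomp Require Import all_boot.

Set Implicit Arguments.
Unset Strict Implicit.
Unset Printing Implicit Defensive.

(* The ground set {1, ..., n + r} is rendered as 'I_(n + r) = {0, ..., n+r-1};
   the elements 1, ..., r are the i : 'I_(n + r) with i < r. *)
Section RDowling.

Variables m x lambda r n : nat.

Local Notation T := 'I_(n + r).

Definition special_separated (P : {set {set T}}) : bool :=
  [forall i : T, forall j : T,
     [&& i < r, j < r & i != j] ==> (pblock P i != pblock P j)].

Definition distinguished (B : {set T}) : bool := [exists i in B, i < r].

Definition nondistinguished_block (P : {set {set T}}) (B : {set T}) : bool :=
  (B \in P) && ~~ distinguished B.

Definition largest_in (B : {set T}) (i : T) : bool :=
  (i \in B) && [forall j in B, j <= i].

Definition colored_elt (P : {set {set T}}) (i : T) : bool :=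
  [exists B : {set T},
     [&& nondistinguished_block P B, i \in B & ~~ largest_in B i]].

(* A decorated partition is a tuple (P, c, b, s): P is the set of blocks, and
   c, b, s are partial functions giving the colors of the elements, the colors
   of the blocks and the sections of the blocks.  The value None means
   "undefined"; the domain of each partial function is prescribed exactly by
   the predicate below, so that nothing is counted twice. *)
Definition decorated_partition : finType :=
  ({set {set T}} * {ffun T -> option 'I_m} *
   {ffun {set T} -> option 'I_x} * {ffun {set T} -> option 'I_lambda})%type.

Definition is_rdowling_partition (d : decorated_partition) : bool :=
  let: (P, c, b, s) := d in
  [&& partition P [set: T],
      special_separated P,
      [forall i : T, isSome (c i) == colored_elt P i],
      [forall B : {set T}, isSome (b B) == nondistinguished_block P B]
    & [forall B : {set T}, isSome (s B) == nondistinguished_block P B]].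

Definition rdowling : nat := #|[set d | is_rdowling_partition d]|.

End RDowling.

(* Main.v *)
Require Import Defs.
From mathcomp Require Import all_boot.

Set Implicit Arguments.
Unset Strict Implicit.
Unset Printing Implicit Defensive.

(** Summing over the decorations first turns the count into a sum over set
    partitions P of the product over B in P of a weight w(B).  A block without
    special element has weight x * lambda * m ^ (#|B| - 1): it has one color,
    one section, and a color for every element but its maximum, so that the
    order of the ground set disappears.  A block with exactly one special
    element has weight 1, and one with several has weight 0, which encodes the
    separation of the special elements.

    Splitting off the block of a chosen element a shows that such a sum over
    the partitions of the union of V (special) and U (not special) depends only
    on r = #|V| and k = #|U|.  Call it D r k.  The companions of a form a subset
    C of U, if the weight is not 0 and a is special or V is empty.  So D is
    governed by binomial convolutions, written h * g below, where q^. is the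
    sequence of the powers of q:
    - for a special, D (r + 1) = 1 * D r, since the block has weight 1;
    - for a not special and r = 0, D 0 (k + 1) = x lambda (m^. * D 0) (k), since
      the block has weight x lambda m ^ #|C|.

    Both rules determine D, and the solution D of the recurrence of the theorem
    with D r 0 = 1 satisfies them: they are the cases q = 1 and (q, r) = (m, 0)
    of the identity q^. * D r = D (q + r)
    (lemma [binom_conv_dowling]): coloring the elements of C with q colors
    amounts to placing them in q further distinguished blocks.  That identity
    is an induction using only the Leibniz rule for the convolution, and with
    it the recurrence computes the partition sum ([partition_sum_dowling]),
    hence the number of decorated partitions ([rdowling_rec]). *)

(** * Binomial convolution and the Dowling recurrence *)

(** The binomial convolution sum_j 'C(n, j) h(j) g(n - j), given by the Leibniz
    rule for the shift operator, a form that matches both the recurrence of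
    [dowling_rec] and the induction on a finite set in
    [sum_subsets_binom_conv]. *)
Fixpoint binom_conv (h g : nat -> nat) n : nat :=
  if n is n'.+1 then
    binom_conv (h \o succn) g n' + binom_conv h (g \o succn) n'
  else h 0 * g 0.

Lemma eq_binom_conv h h' g g' n :
  h =1 h' -> g =1 g' -> binom_conv h g n = binom_conv h' g' n.
Proof.
elim: n h h' g g' => [|n IHn] h h' g g' eqh eqg /=; first by rewrite eqh eqg.
by congr (_ + _); apply: IHn => // i /=; rewrite (eqh, eqg).
Qed.

Lemma binom_convZl a h g n :
  binom_conv (fun i => a * h i) g n = a * binom_conv h g n.
Proof.
elim: n h g => [|n IHn] h g /=; first by rewrite mulnA.
by rewrite mulnDr -!IHn.
Qed.

Lemma binom_conv_linr a b h g g' n :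
  binom_conv h (fun i => a * g i + b * g' i) n =
  a * binom_conv h g n + b * binom_conv h g' n.
Proof.
elim: n h g g' => [|n IHn] h g g' /=.
  by rewrite mulnDr; congr (_ + _); rewrite mulnCA.
rewrite (IHn (h \o succn)) (IHn h (g \o succn) (g' \o succn)).
by rewrite !mulnDr addnACA.
Qed.

(** Here c stands for x * lambda, the number of ways to color a block and to
    place it in a section. *)
Fixpoint dowling_rec c m r k : nat :=
  if k is k'.+1 then
    r * dowling_rec c m r k' + c * dowling_rec c m (m + r) k'
  else 1.

(** Elements colored with q colors can be seen as lying in q extra
    distinguished blocks.  By the Leibniz rule, the n + 1 case is
    q D (q + r) + (r D (q + r) + c D (q + m + r)), which is the recurrence
    at q + r. *)
Lemma binom_conv_dowling c m q r n :
  binom_conv (expn q) (dowling_rec c m r) n = dowling_rec c m (q + r) n.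
Proof.
elim: n q r => [|n IHn] q r //=.
rewrite (@eq_binom_conv _ (fun i => q * q ^ i) _ (dowling_rec c m r));
  [|by move=> i /=; rewrite expnS|by []].
rewrite binom_convZl IHn.
rewrite (@eq_binom_conv _ (expn q) _
  (fun i => r * dowling_rec c m r i + c * dowling_rec c m (m + r) i)) //.
by rewrite binom_conv_linr !IHn addnA -mulnDl (addnCA q m r).
Qed.

(** * Sums over subsets *)

Section SubsetSums.

Variable T : finType.
Implicit Types (a : T) (U : {set T}).

Lemma sum_subsetsU1_with a U (F : {set T} -> nat) : a \notin U ->
  \sum_(B : {set T} | (B \subset a |: U) && (a \in B)) F B =
  \sum_(C : {set T} | C \subset U) F (a |: C).
Proof.
move=> aU; rewrite (reindex_onto (fun C => a |: C) (fun B : {set T} => B :\ a)).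
  apply: eq_bigl => C; rewrite setU11 andbT.
  apply/andP/idP => [[sCU /eqP eC]|sCU].
    by rewrite -eC -(setU1K aU) setSD.
  have aC : a \notin C by apply: contra aU; apply: (subsetP sCU).
  by rewrite setUS // setU1K.
by move=> B /andP[_ aB]; rewrite setD1K.
Qed.

Lemma sum_subsetsU1 a U (F : {set T} -> nat) : a \notin U ->
  \sum_(B : {set T} | B \subset a |: U) F B =
  \sum_(C : {set T} | C \subset U) F (a |: C) +
  \sum_(C : {set T} | C \subset U) F C.
Proof.
move=> aU; rewrite (bigID (fun B : {set T} => a \in B)) /=.
rewrite sum_subsetsU1_with //; congr (_ + _); apply: eq_bigl => C.
by rewrite -{2}(setU1K aU) subsetD1.
Qed.

(** Whether C contains a given element a of U or not produces the two terms of
    the Leibniz rule. *)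
Lemma sum_subsets_binom_conv U (h g : nat -> nat) :
  \sum_(C : {set T} | C \subset U) h #|C| * g #|U :\: C| = binom_conv h g #|U|.
Proof.
have [n] := ubnP #|U|.
elim: n U h g => [|n IHn] // U h g leUn.
have [-> | [a aU]] := set_0Vmem U.
  by rewrite (big_pred1 set0) ?set0D ?cards0 // => C; exact: subset0.
move: leUn; rewrite -{}(setD1K aU).
move: (U :\ a) (negbT (setD11 a U)) => {U aU} V aV.
rewrite cardsU1 aV add1n ltnS => leVn; rewrite (sum_subsetsU1 _ aV) /=.
rewrite -!(IHn V) //.
congr (_ + _); apply: eq_bigr => C sCV /=.
all: have aC := contraNN (subsetP sCV a) aV.
  rewrite cardsU1 aC add1n; congr (_ * g #|pred_of_set _|).
  apply/setP=> y; rewrite !inE negb_or.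
  by case: eqP => [->|_] //=; rewrite (negPf aV) andbF.
rewrite setDUl (setDidPl _) ?disjoints1 //.
by rewrite cardsU1 inE (negPf aV) andbF.
Qed.

End SubsetSums.

(** * Multiplicative sums over set partitions *)

Section PartitionSums.

Variable T : finType.
Implicit Types (a : T) (S : {set T}) (w : {set T} -> nat).

Definition partition_sum w S : nat :=
  \sum_(P : {set {set T}} | partition P S) \prod_(B in P) w B.

Lemma partition_sum0 w : partition_sum w set0 = 1.
Proof.
rewrite /partition_sum (big_pred1 set0) ?big_set0 // => P.
exact: partition_set0.
Qed.

(** A partition is determined by the block a |: C of a and by the partition
    that it induces on the other elements. *)
Lemma partition_sumU1 w a S : a \notin S ->
  partition_sum w (a |: S) =
  \sum_(C : {set T} | C \subset S) w (a |: C) * partition_sum w (S :\: C).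
Proof.
move=> aS; set aSs := a |: S.
pose F B := w B * partition_sum w (aSs :\: B).
have -> : \sum_(C : {set T} | C \subset S)
            w (a |: C) * partition_sum w (S :\: C) =
          \sum_(C : {set T} | C \subset S) F (a |: C).
  apply: eq_bigr => C sCS; rewrite /F; congr (_ * partition_sum w _).
  apply/setP=> y; rewrite !inE negb_or.
  by case: eqP => [->|_] //=; rewrite (negPf aS) andbF.
rewrite -sum_subsetsU1_with // {1}/partition_sum.
rewrite (partition_big (fun P => pblock P a)
          (fun B : {set T} => (B \subset aSs) && (a \in B))) /=; last first.
  move=> P Pp; have aP : a \in cover P by rewrite (cover_partition Pp) setU11.
  by rewrite mem_pblock aP (partitionS Pp) // pblock_mem.
apply: eq_bigr => B /andP[sB aB]; rewrite /F /partition_sum big_distrr /=.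
rewrite (reindex_onto (fun Q => B |: Q) (fun P => P :\ B)); last first.
  move=> P /andP[Pp /eqP <-]; rewrite setD1K // pblock_mem //.
  by rewrite (cover_partition Pp) setU11.
(* Q lives on the complement of B, so that adding B to Q is injective. *)
have notin Q : partition Q (aSs :\: B) -> B \notin Q.
  move=> Qp; apply/negP => BQ; have /subsetP/(_ _ aB) := partitionS Qp BQ.
  by rewrite inE aB.
apply: eq_big => [Q|Q].
  apply/andP/idP => [[/andP[Pp _] /eqP <-]|Qp].
    by apply: partitionD1; rewrite ?setU11.
  have Pp : partition (B |: Q) aSs.
    rewrite -[aSs](setID _ B) (setIidPr sB); apply: partitionU1 => //.
      by apply/set0Pn; exists a.
    by rewrite disjoints_subset setDE setCI setCK subsetUr.
  rewrite Pp setU1K ?notin // eqxx.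
  by rewrite (def_pblock (partition_trivIset Pp) (setU11 _ _) aB) eqxx.
move=> /andP[/andP[Pp _] /eqP eQ]; rewrite big_setU1 //.
by rewrite -eQ setD11.
Qed.

End PartitionSums.

Section BlockWeight.

Variables (T : finType) (c m : nat) (R : {set T}).

(** R is the set of special elements.  In the second branch a boolean is
    coerced to nat, so that a block with at least two special elements
    annihilates the weight of its partition. *)
Definition block_weight (B : {set T}) : nat :=
  if B :&: R == set0 then c * m ^ #|B|.-1 else #|B :&: R| == 1.

(** Induction on the number of elements, removing the block of a special
    element as long as there is one.  Both cases are [binom_conv_dowling], with
    q = 1 when the removed block is distinguished, and with q = m when it is
    not, which occurs when V is empty. *)
Lemma partition_sum_dowling (V U : {set T}) :
  V \subset R -> [disjoint U & R] ->
  partition_sum block_weight (V :|: U) = dowling_rec c m #|V| #|U|.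
Proof.
have [n] := ubnP (#|V| + #|U|).
elim: n V U => [|n IHn] // V U leVU sVR dUR.
have [V0 | [a aV]] := set_0Vmem V; last first.
  (* The block of a has nonzero weight only if its other elements are in U. *)
  move: leVU sVR; rewrite -{}(setD1K aV).
  move: (V :\ a) (negbT (setD11 a V)) => {V aV} V aV.
  rewrite cardsU1 aV add1n ltnS => leVU.
  rewrite subUset sub1set => /andP[aR sVR].
  have aU : a \notin U by apply: contraL aR => /(disjointFr dUR)->.
  have aVU : a \notin V :|: U by rewrite inE negb_or aV.
  rewrite -setUA partition_sumU1 // (bigID (fun C : {set T} => C \subset U)) /=.
  rewrite [X in _ + X]big1 ?addn0 => [|C /andP[sCVU]]; last first.
    case/subsetPn=> b bC bU; rewrite /block_weight.
    have bV : b \in V.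
      by move/subsetP/(_ b bC): sCVU; rewrite inE (negPf bU) orbF.
    have bR := subsetP sVR b bV.
    have neq_ba : b != a by apply: contraNneq aV => <-.
    have sabR : [set a; b] \subset (a |: C) :&: R.
      apply/subsetP=> y; rewrite !inE.
      by case/orP=> /eqP->; rewrite ?eqxx ?aR ?bC ?orbT.
    have := subset_leq_card sabR; rewrite cards2 eq_sym neq_ba => le2.
    by rewrite -cards_eq0; case: #|_| le2 => [|[|k]].
  rewrite -(add1n #|V|) -binom_conv_dowling -sum_subsets_binom_conv.
  apply: eq_big => [C|C /andP[_ sCU]].
    by rewrite andbC; apply: andb_idr => sCU; rewrite subsetU // sCU orbT.
  have -> : block_weight (a |: C) = 1.
    have CR : C :&: R = set0.
      by apply/eqP; rewrite setI_eq0; apply: disjointWl dUR.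
    rewrite /block_weight setIUl CR setU0 (setIidPl _) ?sub1set // cards1.
    by rewrite -cards_eq0 cards1.
  have dCV : [disjoint V & C].
    by rewrite disjoint_sym (disjointWr sVR) // (disjointWl sCU).
  rewrite exp1n !mul1n setDUl (setDidPl dCV).
  rewrite IHn ?(disjointWl (subsetDl _ _)) //.
  by apply: leq_ltn_trans leVU; rewrite leq_add2l subset_leq_card ?subsetDl.
(* No special element is left: the block of a is not distinguished. *)
rewrite {V sVR}V0 set0U cards0 add0n in leVU *.
have [-> | [a aU]] := set_0Vmem U; first by rewrite partition_sum0 cards0.
move: leVU dUR; rewrite -{}(setD1K aU).
move: (U :\ a) (negbT (setD11 a U)) => {U aU} U aU.
rewrite cardsU1 aU add1n ltnS => leU.
move=> dUR; rewrite partition_sumU1 //= mul0n add0n.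
rewrite -binom_conv_dowling -sum_subsets_binom_conv big_distrr /=.
apply: eq_bigr => C sCU; rewrite mulnA; congr (_ * _).
  have -> : block_weight (a |: C) = c * m ^ #|a |: C|.-1.
    rewrite /block_weight ifT // setI_eq0; apply: disjointWl dUR.
    exact: setUS.
  by rewrite cardsU1 (contraNN (subsetP sCU a) aU) add1n.
rewrite -[X in partition_sum _ X]set0U IHn ?cards0 ?sub0set //.
  by apply: leq_ltn_trans leU; rewrite add0n subset_leq_card ?subsetDl.
apply: disjointWl dUR; exact: subset_trans (subsetDl _ _) (subsetUr _ _).
Qed.

End BlockWeight.
(** * Counting the decorations of a partition *)

Lemma card_partial_ffun (T : finType) k (A : {pred T}) :
  #|[set f : {ffun T -> option 'I_k} | [forall i, isSome (f i) == A i]]| =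
  k ^ #|A|.
Proof.
have -> : k ^ #|A| = #|predC1 (@None 'I_k)| ^ #|A|.
  by rewrite cardC1 card_option card_ord.
rewrite -(card_pffun_on None); apply: eq_card => f; rewrite inE.
apply/forallP/pffun_onP => [domf|[/subsetP supf imf] i].
  split=> [|_ /imageP[i Ai ->]]; first apply/subsetP=> i; rewrite inE.
    by move: (domf i) => /eqP; rewrite unfold_in => <-; case: (f i).
  by move: (domf i) => /eqP; rewrite -[A i]/(i \in A) Ai; case: (f i).
apply/eqP; rewrite -[A i]/(i \in A); apply/idP/idP => [|Ai].
  by move: (supf i); rewrite inE; case: (f i) => // y ->.
by move: (imf (f i) (image_f f Ai)); rewrite inE; case: (f i).
Qed.

Section Counting.

Variables m x lambda r n : nat.
Local Notation T := 'I_(n + r).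
Local Notation special := [set i : T | i < r].
Local Notation weight := (block_weight (x * lambda) m special).

Lemma rdowling_sum_partitions :
  rdowling m x lambda r n =
  \sum_(P : {set {set T}} | partition P [set: T] && special_separated P)
     m ^ #|colored_elt P| * x ^ #|nondistinguished_block P|
                          * lambda ^ #|nondistinguished_block P|.
Proof.
rewrite /rdowling -sum1_card.
rewrite (partition_big (fun d => d.1.1.1)
  (fun P => partition P [set: T] && special_separated P)) /=; last first.
  by move=> [[[P c] b] s]; rewrite inE /= => /and5P[-> ->].
apply: eq_bigr => P Pp; rewrite sum1dep_card -!card_partial_ffun.
rewrite -[X in X * _ * _]mul1n -(cards1 P) -!cardsX.
apply: eq_card => -[[[Q c] b] s]; rewrite !inE /=.
apply/andP/andP => [[/and5P[_ _ c_ b_ s_] /eqP eQ]|].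
  by rewrite -eQ eqxx c_ b_ s_.
by case=> /andP[/andP[/eqP -> ->] ->] ->; case/andP: Pp => -> ->; rewrite eqxx.
Qed.

Lemma distinguishedE (B : {set T}) : distinguished B = (B :&: special != set0).
Proof.
apply/existsP/set0Pn => -[i].
  by case/andP=> iB ir; exists i; rewrite !inE iB.
by rewrite !inE => /andP[iB ir]; exists i; rewrite iB.
Qed.

Lemma special_separatedE (P : {set {set T}}) : partition P [set: T] ->
  special_separated P = [forall B in P, #|B :&: special| <= 1].
Proof.
move=> Pp; have tiP := partition_trivIset Pp; have covP := cover_partition Pp.
apply/forallP/forall_inP => [sepP B PB|le1 i].
  apply/card_le1_eqP => i j; rewrite !inE => /andP[iB ir] /andP[jB jr].
  apply/eqP; move/forallP/(_ j): (sepP i); rewrite ir jr /=.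
  by rewrite !(def_pblock tiP PB) // eqxx eq_sym; case: (j == i).
apply/forallP=> j; apply/implyP=> /and3P[ir jr]; apply: contraNneq => eqB.
have mem_block k : k \in pblock P k by rewrite mem_pblock covP inE.
have /le1/card_le1_eqP : pblock P i \in P by rewrite pblock_mem // covP inE.
by move/(_ i j)->; rewrite // !inE ?mem_block ?ir //= eqB mem_block.
Qed.

Lemma card_not_largest (B : {set T}) : B != set0 ->
  #|[pred i in B | ~~ largest_in B i]| = #|B|.-1.
Proof.
case/set0Pn=> i0 Bi0; have [k Bk kmax] := arg_maxnP (fun i : T => i : nat) Bi0.
rewrite [in RHS](cardsD1 k) [k \in B]Bk /= -(@eq_card _ (mem (B :\ k))) // => i.
rewrite !inE [LHS]andbC; apply: andb_id2l => iB; congr (~~ _).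
apply/eqP/idP => [->|/andP[_ /forall_inP/(_ k Bk) le_ki]].
  by rewrite /largest_in [k \in B]Bk; apply/forall_inP => j; apply: kmax.
by apply/val_inj/eqP; rewrite eqn_leq le_ki andbT; apply: kmax.
Qed.

(** A block of a partition is the only one that contains a given element of
    it, so that being colored can be tested inside the block. *)
Lemma card_colored_in_block (P : {set {set T}}) B :
  partition P [set: T] -> B \in P ->
  #|[pred i in B | colored_elt P i]| =
  if distinguished B then 0 else #|B|.-1.
Proof.
move=> Pp PB.
have colE i : i \in B ->
    colored_elt P i = ~~ distinguished B && ~~ largest_in B i.
  move=> iB; apply/existsP/andP => [[C /and3P[/andP[PC ndC] iC nlC]]|[ndB nlB]].
    have tiP := partition_trivIset Pp.
    have <- : C = B by rewrite -(def_pblock tiP PC iC) (def_pblock tiP PB iB).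
    by [].
  by exists B; rewrite /nondistinguished_block PB ndB iB.
case: ifP => distB; last rewrite -card_not_largest ?(partition_neq0 Pp) //.
  apply: eq_card0 => i; rewrite !inE; apply/andP => -[/colE->].
  by rewrite distB.
apply: eq_card => i; rewrite !inE; apply: andb_id2l => /colE->.
by rewrite distB.
Qed.

Lemma decorations_block_weight (P : {set {set T}}) :
  partition P [set: T] -> special_separated P ->
  m ^ #|colored_elt P| * x ^ #|nondistinguished_block P|
                       * lambda ^ #|nondistinguished_block P| =
  \prod_(B in P) weight B.
Proof.
move=> Pp; rewrite (special_separatedE Pp) => /forall_inP le1.
have card_col : #|colored_elt P| =
    \sum_(B in P) #|[pred i in B | colored_elt P i]|.
  rewrite -sum1_card (eq_bigl (fun i => (i \in [set: T]) && colored_elt P i)).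
    rewrite (set_partition_big_cond _ Pp) /=.
    by apply: eq_bigr => B _; rewrite sum1dep_card cardsE.
  by move=> i; rewrite inE.
have card_nd : #|nondistinguished_block P| = \sum_(B in P) ~~ distinguished B.
  by rewrite -sum1_card [LHS]big_mkcondr; apply: eq_bigr => B _; case: ifP.
rewrite card_col card_nd !expn_sum -!big_split /=; apply: eq_bigr => B PB.
rewrite card_colored_in_block // /block_weight distinguishedE.
case: eqVneq => [_|specB] /=; first by rewrite !expn1 -mulnA mulnC.
move: (le1 B PB); rewrite leq_eqVlt ltnS leqn0 cards_eq0 (negPf specB) orbF.
by move=> ->; rewrite !expn0.
Qed.

(** Partitions that do not separate the special elements are absent from the
    left-hand side, and contribute 0 to the right-hand side. *)
Lemma rdowling_partition_sum :
  rdowling m x lambda r n = partition_sum weight [set: T].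
Proof.
rewrite rdowling_sum_partitions /partition_sum.
rewrite [RHS](bigID (@special_separated r n)) /=.
rewrite [X in _ = _ + X]big1 ?addn0 => [|P /andP[Pp]].
  by apply: eq_bigr => P /andP[]; apply: decorations_block_weight.
rewrite special_separatedE // => /forall_inPn[B PB gt1].
apply/eqP; rewrite (big_setD1 B) //= muln_eq0 /block_weight.
by move: gt1; rewrite -cards_eq0; case: #|_| => [|[|]].
Qed.

(** [partition_sum_dowling] for V the r special elements and U the n others. *)
Lemma rdowling_rec : rdowling m x lambda r n = dowling_rec (x * lambda) m r n.
Proof.
rewrite rdowling_partition_sum -(setUCr special).
rewrite partition_sum_dowling //; last by rewrite disjoints_subset.
have card_special : #|special| = r.
  have le_r : r <= n + r by rewrite leq_addl.
  have widen_inj : injective (widen_ord le_r).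
    by move=> i j /(congr1 val) /= /val_inj.
  rewrite -[RHS]card_ord -(card_imset _ widen_inj).
  apply: eq_card => i; rewrite inE; apply/idP/imsetP => [ir|[j _ ->]].
    by exists (Ordinal ir) => //; apply: val_inj.
  by rewrite /= ltn_ord.
by rewrite card_special cardsCs setCK card_ord card_special addnK.
Qed.

End Counting.

Theorem theorem3p2 (n lambda r m x : nat) (hm : 0 < m) (hx : 0 < x) :
  rdowling m x lambda r n.+1 =
    r * rdowling m x lambda r n + x * lambda * rdowling m x lambda (m + r) n.
Proof. by rewrite !rdowling_rec. Qed.
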